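(* Let $p(z)=z^n+a_{n-1}z^{n-1}+\cdots+a_1z+a_0$ be a monic polynomial of degree $n$ with coefficients $a_0,\dots,a_{n-1}\in\mathbb{C}$, let $C(p)$ be its Frobenius companion matrix, and let $\lambda$ be a zero of $p(z)$. Then $$|\lambda|\le w(C(p))\le\left(\frac14\beta\sqrt{\alpha}+\frac14\alpha+\frac12\beta^2\right)^{\frac12},$$ where $$\alpha=\left[1+\sum_{r=0}^{n-1}\left(|a_r|^2+|b_r|^2\right)\right]^{\frac12},$$ $$\beta=\left[\frac12\left(1+\sum_{r=0}^{n-1}|a_r|^2+\sqrt{\left(1+\sum_{r=0}^{n-1}|a_r|^2\right)^2-4|a_0|^2}\right)\right]^{\frac12},$$ and $b_r=a_{n-1}a_r-a_{r-1}$ for each $r=0,1,\dots,n-1$, with $a_{-1}=0$.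
   Context: The Frobenius companion matrix of $p$ is the $n\times n$ matrix $$C(p)=\begin{pmatrix}-a_{n-1}&-a_{n-2}&\cdots&-a_1&-a_0\\1&0&\cdots&0&0\\0&1&\cdots&0&0\\\vdots&\vdots&&\vdots&\vdots\\0&0&\cdots&1&0\end{pmatrix},$$ regarded as an operator on $\mathbb{C}^n$ with the usual inner product. The numerical radius of an operator $T$ on $\mathbb{C}^n$ is $w(T)=\sup\{|\langle Tx,x\rangle| : x\in\mathbb{C}^n,\ \|x\|=1\}$. *)

(* Defs.v *)
From HB Require Import structures.
From mathcomp Require Import all_boot all_order all_algebra.
From mathcomp Require Import spectral.
From mathcomp Require Import all_classical reals.
From mathcomp Require Import complex.

Set Implicit Arguments.
Unset Strict Implicit.
Unset Printing Implicit Defensive.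

Import Order.TTheory GRing.Theory Num.Theory.
Local Open Scope ring_scope.
Local Open Scope classical_set_scope.

(* The modulus as an element of R; the library's `|z| lives in R[i], where
   `|z| = (cmod z)%:C. *)
Notation cmod := ComplexField.Normc.normc.

(* [mxpoly.companionmx] is another arrangement of the same coefficients: there
   they fill the last row in increasing order.  Here they fill the first row in
   decreasing order, above a subdiagonal of ones. *)
Definition frobenius_mx {R : nzRingType} (p : seq R) (d := (size p).-1) :
    'M[R]_d :=
  \matrix_(i < d, j < d)
    if i == 0%N :> nat then - p`_(d.-1 - j) else (i == j.+1 :> nat)%:R.

Section NumericalRadius.
Variables (R : realType) (n : nat).
Implicit Types (x y : 'cV[R[i]]_n) (T : 'M[R[i]]_n).

(* [dotmx] is defined on row vectors: dotmx u v = \sum_i u_i * (v_i)^*. *)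
Definition cdot x y : R[i] := dotmx x^T y^T.

Definition cnorm x : R := Num.sqrt (complex.Re (cdot x x)).

(* For 0 < n the set is nonempty and bounded, so [sup] is the actual supremum. *)
Definition numerical_radius T : R :=
  sup [set cmod (cdot (T *m x) x) | x in [set x | cnorm x = 1]].

End NumericalRadius.

(* Main.v *)
Require Import Defs.
From HB Require Import structures.
From mathcomp Require Import all_boot all_order all_algebra.
From mathcomp Require Import sesquilinear spectral.
From mathcomp Require Import all_classical reals.
From mathcomp Require Import complex.
From mathcomp Require Import ring lra.

(** The lower bound: [lambda] is an eigenvalue of the companion matrix [C],
    with eigenvector [(lambda^(n-1), ..., lambda, 1)], and the numerical range
    of a matrix contains its eigenvalues.

    The upper bound rests on an inequality valid for every matrix [T] and every
    unit vector [x],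
      [2 |<Tx,x>|^2 <= ||Tx|| ||T^* x|| + |<T^2 x,x>|],
    which is Buzano's refinement of the Cauchy-Schwarz inequality applied to
    the product [<Tx,x><x,T^* x>] ([buzano], [cdot_sqr_le]).  If [beta] bounds
    [||T||], hence also [||T^*||], and [alpha] bounds [||T^2||], then the first
    term on the right is at most [beta^2], while the second, [m], satisfies both
    [m <= alpha] and [m = |<Tx,T^* x>| <= beta^2].  Hence also
    [m <= beta sqrt(alpha)], and averaging the two bounds on [m] gives
      [|<Tx,x>|^2 <= beta^2/2 + (beta sqrt(alpha) + alpha)/4]
    ([cdot_le_of_norms]).

    It remains to bound the two norms for [C].  Below its first row [C] is a
    shift, so [||Cx||^2] is the sum of [|sum_j a_j x_j|^2] and of the squared
    moduli of all the entries of [x] but the last.  Applying Cauchy-Schwarz to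
    all the terms of the first sum except the one with [a_0] reduces
    [||C|| <= beta] to a quadratic form in two real variables, of trace
    [1 + sum |a_r|^2] and determinant [|a_0|^2], whose larger eigenvalue is
    [beta^2] ([companion_le]).  The first row of [C^2] has the coefficients
    [b_r], its second row, if any, the [- a_r], and the others form a shift;
    therefore Cauchy-Schwarz on these two rows gives [||C^2|| <= alpha]
    ([companion_sqr_le]). *)

Set Implicit Arguments.
Unset Strict Implicit.
Unset Printing Implicit Defensive.

Import Order.TTheory GRing.Theory Num.Theory.
Local Open Scope ring_scope.
Local Open Scope complex_scope.
Local Open Scope sesquilinear_scope.

(** * The Hermitian inner product and Buzano's inequality *)

Lemma cmodE (R : realType) (z : R[i]) : `|z| = (cmod z)%:C.
Proof. by []. Qed.

Lemma cmod_ge0 (R : realType) (z : R[i]) : 0 <= cmod z.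
Proof. by case: z => a b; exact: sqrtr_ge0. Qed.

Lemma cmodJ (R : realType) (z : R[i]) : cmod (Num.conj z) = cmod z.
Proof. by apply: complexI; rewrite -!cmodE norm_conjC. Qed.

Lemma cdotE (R : realType) n (x y : 'cV[R[i]]_n) :
  cdot x y = \sum_i x i 0 * Num.conj (y i 0).
Proof.
by rewrite /cdot dotmxE !mxE; apply: eq_bigr => i _; rewrite !mxE.
Qed.

Lemma cdotBl (R : realType) n (x y z : 'cV[R[i]]_n) :
  cdot (x - y) z = cdot x z - cdot y z.
Proof. by rewrite /cdot linearB /= linearBl. Qed.

Lemma cdotZl (R : realType) n c (x y : 'cV[R[i]]_n) :
  cdot (c *: x) y = c * cdot x y.
Proof. by rewrite /cdot linearZ /= linearZl. Qed.

Lemma cdotC (R : realType) n (x y : 'cV[R[i]]_n) :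
  cdot y x = Num.conj (cdot x y).
Proof. by rewrite /cdot hermC mul1r. Qed.

Lemma cdotZr (R : realType) n c (x y : 'cV[R[i]]_n) :
  cdot x (c *: y) = Num.conj c * cdot x y.
Proof. by rewrite cdotC cdotZl rmorphM /= -cdotC. Qed.

Lemma cdot_adjoint (R : realType) n (T : 'M[R[i]]_n) (x y : 'cV[R[i]]_n) :
  cdot (T *m x) y = cdot x (T ^t* *m y).
Proof.
have TJ : T ^t* ^ Num.conj = T^T by apply/matrixP => i j; rewrite !mxE conjCK.
by rewrite /cdot !dotmxE trmx_mul !trmxK map_mxM /= mulmxA TJ.
Qed.

Lemma cnorm_ge0 (R : realType) n (x : 'cV[R[i]]_n) : 0 <= cnorm x.
Proof. exact: sqrtr_ge0. Qed.

Lemma cnorm_sqr (R : realType) n (x : 'cV[R[i]]_n) :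
  (cnorm x ^+ 2)%:C = cdot x x.
Proof.
have x_ge0 : 0 <= cdot x x by exact: dnorm_ge0.
rewrite /cnorm sqr_sqrtr; last by rewrite -ler0c RRe_real ?ger0_real.
by rewrite RRe_real ?ger0_real.
Qed.

Lemma cnorm_sum (R : realType) n (x : 'cV[R[i]]_n) :
  cnorm x ^+ 2 = \sum_i cmod (x i 0) ^+ 2.
Proof.
apply: complexI; rewrite cnorm_sqr cdotE rmorph_sum /=.
by apply: eq_bigr => i _; rewrite rmorphXn /= -cmodE normCK.
Qed.

Lemma cnorm_eq0 (R : realType) n (x : 'cV[R[i]]_n) : (cnorm x == 0) = (x == 0).
Proof.
have dE : (cdot x x == 0) = (x == 0).
  by rewrite -(trmx_eq0 x); exact: (dnorm_eq0 (@dotmx R[i] n)).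
by rewrite -dE -cnorm_sqr -[0 in RHS](rmorph0 (real_complex R))
           (inj_eq (@complexI R)) expf_eq0.
Qed.

Lemma cauchy_schwarz (R : realType) n (x y : 'cV[R[i]]_n) :
  cmod (cdot x y) <= cnorm x * cnorm y.
Proof.
have CS : `|cdot x y| ^+ 2 <= cdot x x * cdot y y.
  by have [CS _] := CauchySchwarz (@dotmx R[i] n) x^T y^T.
rewrite -(@ler_pXn2r _ 2) ?nnegrE ?mulr_ge0 ?cmod_ge0 ?cnorm_ge0//.
move: CS; rewrite -(cnorm_sqr x) -(cnorm_sqr y) cmodE exprMn.
move: (cnorm x) (cnorm y) (cmod _) => r s c.
by rewrite -!rmorphXn -rmorphM lecR.
Qed.

(** The coefficients enter a matrix product without conjugation; this form of
    Cauchy-Schwarz absorbs the conjugate of the inner product into [x]. *)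
Lemma cauchy_schwarz_sum (R : realType) n (a x : 'I_n -> R[i]) :
  cmod (\sum_i a i * x i) ^+ 2
    <= (\sum_i cmod (a i) ^+ 2) * \sum_i cmod (x i) ^+ 2.
Proof.
pose u := \col_i a i; pose v := \col_i Num.conj (x i).
have := cauchy_schwarz u v; set c := cdot u v => uv.
have -> : \sum_i a i * x i = c.
  by rewrite /c cdotE; apply: eq_bigr => i _; rewrite !mxE conjCK.
have -> : \sum_i cmod (a i) ^+ 2 = cnorm u ^+ 2.
  by rewrite cnorm_sum; apply: eq_bigr => i _; rewrite mxE.
have -> : \sum_i cmod (x i) ^+ 2 = cnorm v ^+ 2.
  by rewrite cnorm_sum; apply: eq_bigr => i _; rewrite mxE cmodJ.
by rewrite -exprMn ler_pXn2r ?nnegrE ?mulr_ge0 ?cmod_ge0 ?cnorm_ge0.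
Qed.

(** The vector [2 <x,e> e - x] is the reflection of [x] in the line of [e], so
    it has the norm of [x]; Cauchy-Schwarz for it and [y] bounds
    [|2 <x,e><e,y> - <x,y>|]. *)
Lemma buzano (R : realType) n (e x y : 'cV[R[i]]_n) : cnorm e = 1 ->
  2 * (cmod (cdot x e) * cmod (cdot e y))
    <= cnorm x * cnorm y + cmod (cdot x y).
Proof.
move=> e1; set c := cdot x e.
have ee : cdot e e = 1 by rewrite -cnorm_sqr e1 expr1n.
pose u := (2 * c) *: e - x.
have cBr z : cdot z u = Num.conj (2 * c) * cdot z e - cdot z x.
  by rewrite (cdotC u) cdotBl cdotZl (cdotC e z) (cdotC x z) rmorphB rmorphM.
have uu : cdot u u = cdot x x.
  rewrite [LHS]cdotBl cdotZl !cBr ee -/c (cdotC x e) -/c rmorphM /= conjC_nat.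
  by ring.
have -> : cnorm x = cnorm u by rewrite /cnorm uu.
have := cauchy_schwarz u y; rewrite cdotBl cdotZl => uy.
have -> : 2 * (cmod c * cmod (cdot e y)) = cmod (2 * c * cdot e y).
  have cmod2 : cmod (1 *+ 2 : R[i]) = 2.
    by rewrite normcMn ComplexField.Normc.normc1.
  by rewrite !ComplexField.Normc.normcM cmod2 mulrA.
rewrite -[2 * c * _](subrK (cdot x y)).
by apply: le_trans (le_normcD _ _) _; rewrite lerD2r.
Qed.

(** * Bounds on the numerical radius *)

Lemma le_sqrtM (R : rcfType) (u v c : R) :
  0 <= u -> 0 <= v -> 0 <= c -> u ^+ 2 <= c * v ^+ 2 -> u <= Num.sqrt c * v.
Proof.
move=> u0 v0 c0 uv; rewrite -(@ler_pXn2r _ 2) ?nnegrE ?mulr_ge0 ?sqrtr_ge0//.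
by rewrite exprMn sqr_sqrtr.
Qed.

(** Since [m <= alpha] and [m <= q <= beta^2], the geometric mean
    [beta sqrt(alpha)] of [beta^2] and [alpha] bounds [m] as well; [m] is then
    bounded by the average of [alpha] and [beta sqrt(alpha)]. *)
Lemma le_sqrt_mean (R : rcfType) (w q m alpha beta : R) :
  0 <= w -> 0 <= m -> 0 <= beta -> q <= beta ^+ 2 -> m <= q -> m <= alpha ->
  2 * w ^+ 2 <= q + m ->
  w <= Num.sqrt (4^-1 * beta * Num.sqrt alpha + 4^-1 * alpha
                 + 2^-1 * beta ^+ 2).
Proof.
move=> w0 m0 b0 q_beta m_q m_alpha w2.
have m_mean : m <= beta * Num.sqrt alpha.
  rewrite -(@ler_pXn2r _ 2) ?nnegrE ?mulr_ge0 ?sqrtr_ge0//.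
  rewrite exprMn sqr_sqrtr; last exact: le_trans m_alpha.
  by rewrite expr2 ler_pM// (le_trans m_q).
rewrite -[leLHS]ger0_norm// -sqrtr_sqr ler_wsqrtr//.
move: w2 q_beta m_alpha m_mean; lra.
Qed.

(** [||T^* x||^2 = <T T^* x, x> <= beta ||T^* x|| ||x||], and one factor
    [||T^* x||] cancels. *)
Lemma cnorm_adjoint_le (R : realType) n (T : 'M[R[i]]_n) (beta : R) :
  (forall x, cnorm (T *m x) <= beta * cnorm x) ->
  forall x, cnorm (T ^t* *m x) <= beta * cnorm x.
Proof.
move=> Tb x; set y := T ^t* *m x.
have [y0|y_neq0] := eqVneq (cnorm y) 0.
  by rewrite y0; apply: le_trans (Tb x); exact: cnorm_ge0.
have y_gt0 : 0 < cnorm y by rewrite lt_def y_neq0 cnorm_ge0.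
rewrite -(ler_pM2l y_gt0) -expr2 mulrA (mulrC (cnorm y)).
have -> : cnorm y ^+ 2 = cmod (cdot (T *m y) x).
  apply: complexI; rewrite cdot_adjoint -/y -cmodE cnorm_sqr.
  by rewrite ger0_norm// -cnorm_sqr ler0c sqr_ge0.
apply: le_trans (cauchy_schwarz _ _) _.
by rewrite ler_wpM2r ?cnorm_ge0.
Qed.

(** [buzano] for the vectors [T x] and [T^* x], whose inner products with [x]
    and with each other are [<T x,x>], its conjugate and [<T^2 x,x>]. *)
Lemma cdot_sqr_le (R : realType) n (T : 'M[R[i]]_n) (x : 'cV[R[i]]_n) :
  cnorm x = 1 ->
  2 * cmod (cdot (T *m x) x) ^+ 2
    <= cnorm (T *m x) * cnorm (T ^t* *m x) + cmod (cdot (T *m (T *m x)) x).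
Proof.
move=> x1; rewrite expr2 [cdot (T *m (T *m x)) x]cdot_adjoint.
rewrite {2}[cdot (T *m x) x]cdot_adjoint; exact: buzano.
Qed.

(** The numbers [|<T^2 x,x>|] and [||T x|| ||T^* x||] of [cdot_sqr_le] take the
    parts of [m] and [q] in [le_sqrt_mean]. *)
Lemma cdot_le_of_norms (R : realType) n (T : 'M[R[i]]_n) (alpha beta : R) :
  0 <= beta ->
  (forall x, cnorm (T *m x) <= beta * cnorm x) ->
  (forall x, cnorm (T *m (T *m x)) <= alpha * cnorm x) ->
  forall x, cnorm x = 1 ->
  cmod (cdot (T *m x) x) <=
    Num.sqrt (4^-1 * beta * Num.sqrt alpha + 4^-1 * alpha + 2^-1 * beta ^+ 2).
Proof.
move=> b0 Tb TTa x x1.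
have Tx : cnorm (T *m x) <= beta.
  by have := Tb x; rewrite [X in _ * X]x1 mulr1.
have Tax : cnorm (T ^t* *m x) <= beta.
  by have := cnorm_adjoint_le Tb x; rewrite [X in _ * X]x1 mulr1.
have TTx : cnorm (T *m (T *m x)) <= alpha.
  by have := TTa x; rewrite [X in _ * X]x1 mulr1.
have cs1 y : cmod (cdot y x) <= cnorm y.
  by have := cauchy_schwarz y x; rewrite [X in _ * X]x1 mulr1.
apply: (le_sqrt_mean _ _ b0 _ _ _ (cdot_sqr_le T x1)); rewrite ?cmod_ge0//.
- rewrite expr2.
  apply: ler_pM; [exact: cnorm_ge0| exact: cnorm_ge0| exact: Tx| exact: Tax].
- by rewrite cdot_adjoint; exact: cauchy_schwarz.
- exact: (le_trans (cs1 (T *m (T *m x))) TTx).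
Qed.

(** The Frobenius norm bounds the operator norm.  Only its finiteness matters:
    it makes the set defining the numerical radius bounded, without which the
    supremum would carry no information. *)
Lemma cnorm_mulmx_le (R : realType) n (T : 'M[R[i]]_n) (x : 'cV[R[i]]_n) :
  cnorm (T *m x) <= Num.sqrt (\sum_i \sum_j cmod (T i j) ^+ 2) * cnorm x.
Proof.
have F0 : 0 <= \sum_i \sum_j cmod (T i j) ^+ 2.
  by apply: sumr_ge0 => i _; apply: sumr_ge0 => j _; exact: sqr_ge0.
apply: le_sqrtM; [exact: cnorm_ge0 | exact: cnorm_ge0 | exact: F0 |].
rewrite [leLHS]cnorm_sum [X in _ * X]cnorm_sum mulr_suml.
by apply: ler_sum => i _; rewrite mxE; exact: cauchy_schwarz_sum.
Qed.

Lemma le_numerical_radius (R : realType) n (T : 'M[R[i]]_n) x :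
  cnorm x = 1 -> cmod (cdot (T *m x) x) <= numerical_radius T.
Proof.
move=> x1; apply: ub_le_sup; last by exists x.
exists (Num.sqrt (\sum_i \sum_j cmod (T i j) ^+ 2)) => _ [y /= y1 <-].
apply: le_trans (cauchy_schwarz _ _) _.
have := cnorm_mulmx_le T y.
by rewrite [X in _ * X]y1 [X in _ * X <= _]y1 !mulr1.
Qed.

Lemma cnorm_normalize (R : realType) n (x : 'cV[R[i]]_n) :
  x != 0 -> cnorm ((cnorm x)^-1%:C *: x) = 1.
Proof.
rewrite -cnorm_eq0 => x0; apply/eqP.
rewrite -(@pexpr_eq1 _ _ 2) ?cnorm_ge0//; apply/eqP/complexI.
rewrite cnorm_sqr cdotZl cdotZr -cnorm_sqr.
have -> : Num.conj (cnorm x)^-1%:C = (cnorm x)^-1%:C.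
  by apply: CrealP; rewrite complex_real.
by rewrite -!rmorphM /= expr2 (mulKf x0) (mulVf x0).
Qed.

Lemma eigenvalue_le_numerical_radius (R : realType) n (T : 'M[R[i]]_n)
    (lambda : R[i]) (x : 'cV[R[i]]_n) :
  x != 0 -> T *m x = lambda *: x -> cmod lambda <= numerical_radius T.
Proof.
move=> /cnorm_normalize; set e := _ *: x => e1 Tx.
apply: le_trans (le_numerical_radius T e1).
have -> : T *m e = lambda *: e by rewrite -scalemxAr Tx !scalerA mulrC.
by rewrite cdotZl -cnorm_sqr e1 expr1n rmorph1 mulr1.
Qed.

(** A positive dimension is what makes unit vectors exist, and the supremum of
    an empty set could exceed [c]. *)
Lemma numerical_radius_le (R : realType) n (T : 'M[R[i]]_n) (c : R) :
  (0 < n)%N -> (forall x, cnorm x = 1 -> cmod (cdot (T *m x) x) <= c) ->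
  numerical_radius T <= c.
Proof.
move=> n_gt0 Tc; have x0 : const_mx 1 != 0 :> 'cV[R[i]]_n.
  apply/eqP => /matrixP /(_ (Ordinal n_gt0) 0) /eqP.
  by rewrite !mxE oner_eq0.
apply: ge_sup; last by move=> _ [x /= x1 <-]; exact: Tc.
pose u : 'cV[R[i]]_n := const_mx 1; pose e := (cnorm u)^-1%:C *: u.
exists (cmod (cdot (T *m e) e)); exists e; last by [].
exact: (cnorm_normalize x0).
Qed.

(** * The norms of a companion matrix and of its square *)

(** The Frobenius matrix with its coefficients read from an arbitrary function
    and its size visibly positive, so that the first and last coordinates of a
    vector can be split off. *)
Definition companion (R : realType) m (a : nat -> R[i]) : 'M[R[i]]_m.+1 :=
  \matrix_(i, j) if i == 0%N :> nat then - a (m - j)%N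
                 else (i == j.+1 :> nat)%:R.

Lemma companion_mul0 (R : realType) m (a : nat -> R[i]) (x : 'cV_m.+1) :
  (companion m a *m x) 0 0 = - \sum_(j < m.+1) a (m - j)%N * x j 0.
Proof.
by rewrite mxE -sumrN; apply: eq_bigr => j _; rewrite mxE mulNr.
Qed.

Lemma companion_mulS (R : realType) m (a : nat -> R[i]) (x : 'cV_m.+1)
    (k : 'I_m) :
  (companion m a *m x) (lift ord0 k) 0 = x (widen_ord (leqnSn m) k) 0.
Proof.
rewrite mxE (bigD1 (widen_ord (leqnSn m) k)) //= mxE /= eqxx mul1r big1 ?addr0//.
move=> j jk; rewrite mxE /= /bump /= add1n eqSS eq_sym.
rewrite -[k : nat]/(widen_ord (leqnSn m) k : nat).
by rewrite (inj_eq val_inj) (negPf jk) mul0r.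
Qed.

Lemma cnorm_companion_mul (R : realType) m (a : nat -> R[i]) (x : 'cV_m.+1) :
  cnorm (companion m a *m x) ^+ 2 =
  cmod (\sum_(j < m.+1) a (m - j)%N * x j 0) ^+ 2
  + \sum_(k < m) cmod (x (widen_ord (leqnSn m) k) 0) ^+ 2.
Proof.
rewrite [LHS]cnorm_sum big_ord_recl companion_mul0 normcN; congr (_ + _).
by apply: eq_bigr => k _; rewrite companion_mulS.
Qed.

Lemma sum_rev (V : nmodType) m (f : nat -> V) :
  \sum_(j < m.+1) f (m - j)%N = \sum_(r < m.+1) f r.
Proof.
rewrite [RHS](reindex_inj rev_ord_inj); apply: eq_bigr => j _.
by rewrite /= subSS.
Qed.

Lemma sum_widen_le (R : realType) m (x : 'cV[R[i]]_m.+1) :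
  \sum_(k < m) cmod (x (widen_ord (leqnSn m) k) 0) ^+ 2 <= cnorm x ^+ 2.
Proof. by rewrite [leRHS]cnorm_sum big_ord_recr /= lerDl sqr_ge0. Qed.

Lemma cmod_row_le (R : realType) m (a : nat -> R[i]) (x : 'cV_m.+1) :
  cmod (\sum_(j < m.+1) a (m - j)%N * x j 0) ^+ 2
    <= (\sum_(r < m.+1) cmod (a r) ^+ 2) * cnorm x ^+ 2.
Proof.
rewrite [X in _ * X]cnorm_sum -(sum_rev m (fun r => cmod (a r) ^+ 2)).
exact: cauchy_schwarz_sum.
Qed.

(** The coefficient of index [r] in the first row of the square of
    [companion m a]. *)
Definition square_coef (R : realType) m (a : nat -> R[i]) (r : nat) : R[i] :=
  a m * a r - (if r is r'.+1 then a r' else 0).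

(** This is the first coordinate of [C (C x)], up to sign.  In the sum on the
    left, the head [a m] of the row meets the first coordinate of [C x] and
    gives the products [a m * a r]; each other coefficient [a r'] meets a
    shifted coordinate of [x], and so ends up at index [r'.+1]. *)
Lemma companion_row_mul (R : realType) m (a : nat -> R[i]) (x : 'cV_m.+1) :
  \sum_(j < m.+1) a (m - j)%N * (companion m a *m x) j 0
  = - \sum_(j < m.+1) square_coef m a (m - j)%N * x j 0.
Proof.
pose pr r := if r is r'.+1 then a r' else 0.
have shift : \sum_(j < m.+1) pr (m - j)%N * x j 0
    = \sum_(k < m) a (m - k.+1)%N * x (widen_ord (leqnSn m) k) 0.
  rewrite big_ord_recr /= subnn mul0r addr0; apply: eq_bigr => k _.
  by rewrite /= -(subnSK (ltn_ord k)).
rewrite big_ord_recl companion_mul0 subn0.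
under [X in _ + X]eq_bigr do rewrite companion_mulS /= /bump /= add1n.
rewrite -shift mulrN mulr_sumr -sumrN -big_split -sumrN; apply: eq_bigr => j _.
by rewrite /square_coef -/(pr _) /=; ring.
Qed.

(** The first coordinate of [C (C x)] is controlled by the coefficients of
    [square_coef].  The others are coordinates of [C x], whose squares sum to at
    most [||C x||^2 <= (1 + sum |a_r|^2) ||x||^2]. *)
Lemma companion_sqr_le (R : realType) m (a : nat -> R[i]) (x : 'cV_m.+1) :
  cnorm (companion m a *m (companion m a *m x)) <=
  Num.sqrt (1 + \sum_(r < m.+1)
     (cmod (a r) ^+ 2 + cmod (square_coef m a r) ^+ 2)) * cnorm x.
Proof.
have sum0 (f : nat -> R[i]) : 0 <= \sum_(r < m.+1) cmod (f r) ^+ 2.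
  by apply: sumr_ge0 => r _; exact: sqr_ge0.
apply: le_sqrtM; [exact: cnorm_ge0 | exact: cnorm_ge0 | |].
  by rewrite addr_ge0// big_split addr_ge0.
have Cx : cnorm (companion m a *m x) ^+ 2
    <= (1 + \sum_(r < m.+1) cmod (a r) ^+ 2) * cnorm x ^+ 2.
  rewrite [leLHS]cnorm_companion_mul mulrDl mul1r [leRHS]addrC.
  exact: (lerD (cmod_row_le a x) (sum_widen_le x)).
rewrite [leLHS]cnorm_companion_mul companion_row_mul normcN.
apply: le_trans (lerD (cmod_row_le (square_coef m a) x)
                      (le_trans (sum_widen_le _) Cx)) _.
by rewrite -mulrDl big_split /= addrCA [X in 1 + X]addrC.
Qed.

(** Here [t] is the larger eigenvalue of the matrix with rows
    [(A^2 + 1, A c)] and [(A c, c^2)], of trace [1 + A^2 + c^2] and determinant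
    [c^2]; it bounds the quadratic form of that matrix.  Explicitly,
    [P = t - A^2 - 1] and [Q = t - c^2] have product [(A c)^2] and sum
    [sqrt D >= 0], hence are nonnegative, and the difference of the two sides is
    the square of [sqrt P u - sqrt Q v]. *)
Lemma eigen2_le (R : realType) (A c u v t : R) :
  0 <= A -> 0 <= c -> 0 <= u -> 0 <= v ->
  t = 2^-1 * ((1 + (A ^+ 2 + c ^+ 2)) +
      Num.sqrt ((1 + (A ^+ 2 + c ^+ 2)) ^+ 2 - 4 * c ^+ 2)) ->
  (A * u + c * v) ^+ 2 + u ^+ 2 <= t * (u ^+ 2 + v ^+ 2).
Proof.
move=> A0 c0 u0 v0; set S := 1 + _; set D := _ - _ => tE.
have D0 : 0 <= D.
  have -> : D = (A ^+ 2 + (c - 1) ^+ 2) * (A ^+ 2 + (c + 1) ^+ 2).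
    by rewrite /D /S; ring.
  by rewrite mulr_ge0 ?addr_ge0 ?sqr_ge0.
have sD : Num.sqrt D ^+ 2 = D by rewrite sqr_sqrtr.
have s0 := sqrtr_ge0 D.
pose P := t - A ^+ 2 - 1; pose Q := t - c ^+ 2.
(* P Q - (A c)^2 is the characteristic polynomial t^2 - S t + c^2. *)
have PQ : P * Q = (A * c) ^+ 2.
  have tt : t ^+ 2 - S * t + c ^+ 2 = 0.
    rewrite tE; transitivity (4^-1 * (Num.sqrt D ^+ 2 - (S ^+ 2 - 4 * c ^+ 2))).
      by field.
    by rewrite sD subrr mulr0.
  transitivity (t ^+ 2 - S * t + c ^+ 2 + (A * c) ^+ 2).
    by rewrite /P /Q /S; ring.
  by rewrite tt add0r.
have PQs : P + Q = Num.sqrt D by rewrite /P /Q tE /S; field.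
have PQ0 : 0 <= P * Q by rewrite PQ sqr_ge0.
have P0 : 0 <= P by nra.
have Q0 : 0 <= Q by nra.
have sPQ : Num.sqrt P * Num.sqrt Q = A * c.
  by rewrite -sqrtrM// PQ sqrtr_sqr ger0_norm// mulr_ge0.
have := sqr_ge0 (Num.sqrt P * u - Num.sqrt Q * v).
have -> : (Num.sqrt P * u - Num.sqrt Q * v) ^+ 2 =
    Num.sqrt P ^+ 2 * u ^+ 2 + Num.sqrt Q ^+ 2 * v ^+ 2
    - 2 * (Num.sqrt P * Num.sqrt Q) * u * v by ring.
rewrite !sqr_sqrtr// sPQ /P /Q; lra.
Qed.

(** With [u] the norm of [x] deprived of its last entry and [v] the modulus of
    that entry, the first coordinate of [C x] is at most [A u + |a 0| v], where
    [A] is the norm of the other coefficients; [eigen2_le] concludes. *)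
Lemma companion_le (R : realType) m (a : nat -> R[i]) (x : 'cV_m.+1) :
  let S := 1 + \sum_(r < m.+1) cmod (a r) ^+ 2 in
  cnorm (companion m a *m x) <=
  Num.sqrt (2^-1 * (S + Num.sqrt (S ^+ 2 - 4 * cmod (a 0%N) ^+ 2))) * cnorm x.
Proof.
pose w := widen_ord (leqnSn m).
pose a2 := \sum_(k < m) cmod (a (m - k)%N) ^+ 2.
pose x2 := \sum_(k < m) cmod (x (w k) 0) ^+ 2.
have a2_ge0 : 0 <= a2 by apply: sumr_ge0 => k _; exact: sqr_ge0.
have x2_ge0 : 0 <= x2 by apply: sumr_ge0 => k _; exact: sqr_ge0.
have SE : \sum_(r < m.+1) cmod (a r) ^+ 2
    = Num.sqrt a2 ^+ 2 + cmod (a 0%N) ^+ 2.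
  rewrite -(sum_rev m (fun r => cmod (a r) ^+ 2)) big_ord_recr /= subnn.
  by rewrite sqr_sqrtr.
rewrite /= SE; set t := 2^-1 * _.
have t_ge0 : 0 <= t.
  by rewrite mulr_ge0 ?invr_ge0// !addr_ge0 ?sqr_ge0 ?sqrtr_ge0.
apply: le_sqrtM; [exact: cnorm_ge0 | exact: cnorm_ge0 | exact: t_ge0 |].
rewrite [leLHS]cnorm_companion_mul [X in _ * X]cnorm_sum -/w -/x2.
rewrite [X in t * X]big_ord_recr [X in cmod X]big_ord_recr /= subnn -/x2.
have := eigen2_le (sqrtr_ge0 a2) (cmod_ge0 (a 0%N)) (sqrtr_ge0 x2)
  (cmod_ge0 (x ord_max 0)) (erefl t).
rewrite (sqr_sqrtr x2_ge0); apply: le_trans; rewrite lerD2r.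
rewrite ler_pXn2r ?nnegrE ?addr_ge0 ?mulr_ge0 ?sqrtr_ge0 ?cmod_ge0//.
apply: le_trans (le_normcD _ _) _; rewrite ComplexField.Normc.normcM lerD2r.
rewrite -sqrtrM// -[leLHS]ger0_norm ?cmod_ge0// -sqrtr_sqr ler_wsqrtr//.
exact: cauchy_schwarz_sum.
Qed.

(** * The bounds for the zeros of a polynomial *)

Lemma companion_eigenvector (R : realType) m (a : nat -> R[i]) (lambda : R[i]) :
  lambda ^+ m.+1 = - \sum_(r < m.+1) a r * lambda ^+ r ->
  let x : 'cV_m.+1 := \col_j lambda ^+ (m - j) in
  x != 0 /\ companion m a *m x = lambda *: x.
Proof.
move=> root_eq x; split.
  apply/eqP => /matrixP /(_ ord_max 0) /eqP.
  by rewrite !mxE /= subnn expr0 oner_eq0.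
apply/matrixP => i j; rewrite (ord1 j) [RHS]mxE [x i 0]mxE -exprS.
case: (unliftP ord0 i) => [k|] ->.
  by rewrite companion_mulS mxE /= /bump /= add1n subnSK.
rewrite companion_mul0 subn0 root_eq -(sum_rev m (fun r => a r * lambda ^+ r)).
by congr (- _); apply: eq_bigr => k _; rewrite mxE.
Qed.

Lemma companion_bounds (R : realType) m (a : nat -> R[i]) (lambda : R[i]) :
  lambda ^+ m.+1 = - \sum_(r < m.+1) a r * lambda ^+ r ->
  let alpha := Num.sqrt (1 + \sum_(r < m.+1)
     (cmod (a r) ^+ 2 + cmod (square_coef m a r) ^+ 2)) in
  let S := 1 + \sum_(r < m.+1) cmod (a r) ^+ 2 in
  let beta :=
    Num.sqrt (2^-1 * (S + Num.sqrt (S ^+ 2 - 4 * cmod (a 0%N) ^+ 2))) in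
  cmod lambda <= numerical_radius (companion m a) /\
  numerical_radius (companion m a) <=
    Num.sqrt (4^-1 * beta * Num.sqrt alpha + 4^-1 * alpha
              + 2^-1 * beta ^+ 2).
Proof.
move=> root_eq alpha S beta; split.
  have [x0 xE] := companion_eigenvector root_eq.
  exact: eigenvalue_le_numerical_radius x0 xE.
apply: numerical_radius_le => //; apply: cdot_le_of_norms.
- exact: sqrtr_ge0.
- exact: companion_le.
- exact: companion_sqr_le.
Qed.

Theorem theorem3p17 (R : realType) (p : {poly R[i]}) (p_monic : p \is monic)
    (lambda : R[i]) (p_lambda : root p lambda) :
  let n := (size p).-1 in
  let a (r : nat) : R[i] := p`_r in
  let b (r : nat) : R[i] :=
    a n.-1 * a r - (if r is r'.+1 then a r' else 0) in
  let alpha : R :=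
    Num.sqrt (1 + \sum_(r < n) (cmod (a r) ^+ 2 + cmod (b r) ^+ 2)) in
  let S : R := 1 + \sum_(r < n) cmod (a r) ^+ 2 in
  let beta : R :=
    Num.sqrt (2^-1 * (S + Num.sqrt (S ^+ 2 - 4 * cmod (a 0%N) ^+ 2))) in
  cmod lambda <= numerical_radius (frobenius_mx p) /\
  numerical_radius (frobenius_mx p) <=
    Num.sqrt (4^-1 * beta * Num.sqrt alpha + 4^-1 * alpha
              + 2^-1 * beta ^+ 2).
Proof.
have p_gt1 : (1 < size p)%N by rewrite (root_size_gt1 _ p_lambda) ?monic_neq0.
have root_eq : lambda ^+ (size p).-1
    = - \sum_(r < (size p).-1) p`_r * lambda ^+ r.
  have := horner_coef p lambda; rewrite (rootP p_lambda).
  move: (monicP p_monic); rewrite lead_coefE; case: (size p) p_gt1 => // d _ /=.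
  by move=> pd; rewrite big_ord_recr /= pd mul1r addrC => /esym/eqP;
     rewrite addr_eq0 => /eqP.
(* Once the list of coefficients has two explicit entries, the predecessor of
   its length reduces to a successor and both matrices have the same type. *)
move: p_gt1 root_eq; case: (polyseq p) => [|c0 [|c1 s]] // _ root_eq.
exact: (@companion_bounds R (size s) (nth 0 [:: c0, c1 & s]) lambda root_eq).
Qed.
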